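(* Let $0<r\le1$. Let $X$ be an r.i. space on $(0,1)$ satisfying an $\alpha$-lower estimate for some $\alpha>1$, let $\psi\in\mathcal{A}_0$, and set $\beta'=\frac{\alpha}{\alpha-r}$. Assume that $$\left\|\frac{\psi(s)^r}{s}\chi_{(0,1)}(s)\right\|_{(X^{(1/r)})'}=\infty$$ and that the function $M(t):=\sup_{t<s<1}\frac{\psi(s)}{\varphi_X(s)}$, $0<t<1$, is bounded. For measurable $f$ put $$A=\left\|\frac{O(|f|^r,\cdot)^{1/r}}{\psi(\cdot)}\right\|_X^r,\qquad m:=(|f|^r)^{**}(1)=\int_0^1(|f|^r)^*(s)\,ds.$$ Then there exist constants $c,C>0$ such that, for every measurable $f$ with $A<\infty$ and $f\in L^r$, $$\int_0^1\exp\left(c\left(\frac{(|f|^r)^{**}(t)-(|f|^r)^{**}(1)}{A}\right)^{\beta'}\right)dt\le C,$$ where, if $A=0$, the quotient is understood in the trivial limiting sense (as $0$). Moreover, $(|f|^r)^{**}(t)-(|f|^r)^{**}(1)\in\exp L^{\beta'}$, with $$\left\|(|f|^r)^{**}(\cdot)-(|f|^r)^{**}(1)\right\|_{\exp L^{\beta'}}\preceq A.$$ Finally, $$\int_0^1\exp\left(c\left(\frac{(|f|^r)^{**}(t)}{A+m}\right)^{\beta'}\right)dt\le C.$$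
   Context: $A\preceq B$ means $A\le cB$ for some constant $c>0$ independent of the relevant functions. In the last display a quotient $0/0$ (which occurs only for $f=0$) is read as $0$. $\exp L^\gamma$ is the Orlicz space on $(0,1)$ with Luxemburg norm $\|g\|_{\exp L^\gamma}=\inf\{\lambda>0:\int_0^1(\exp((|g(t)|/\lambda)^\gamma)-1)\,dt\le1\}$. All function spaces are over $(0,1)$ with Lebesgue measure. The decreasing rearrangement of $f$ is $f^*(s)=\inf\{t>0:|\{x\in(0,1):|f(x)|>t\}|\le s\}$, and $f^{**}(t)=\frac1t\int_0^t f^*(s)\,ds$. For $0<r\le1$, $O(|f|^r,t):=(|f|^r)^{**}(t)-(|f|^r)^*(t)$. $L^r$ is the set of measurable $f$ with $\int_0^1|f|^r<\infty$. An r.i. space $X$ is a Banach function space on $(0,1)$ (in the sense of Bennett--Sharpley) such that $\|f\|_X=\|g\|_X$ whenever $f^*=g^*$; norms are $+\infty$ for functions not in the space. The fundamental function is $\varphi_X(t)=\|\chi_{(0,t)}\|_X$. The associate space $X'$ has norm $\|g\|_{X'}=\sup_{\|f\|_X\le1}\int_0^1|f(s)g(s)|\,ds$. For $p>0$ the $p$-convexification is $X^{(p)}=\{f:|f|^p\in X\}$, $\|f\|_{X^{(p)}}=\||f|^p\|_X^{1/p}$. $X$ satisfies an $\alpha$-lower estimate if there is a constant $C_\alpha>0$ such that for every finite family $\{f_i\}_{i=1}^n$ of functions with pairwise disjoint supports, $(\sum_i\|f_i\|_X^\alpha)^{1/\alpha}\le C_\alpha\|(\sum_i|f_i|^\alpha)^{1/\alpha}\|_X$.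 Class $\mathcal{A}_0$: for a positive function $\psi$ on $(0,1)$ put $m_\psi(t)=\sup\{\psi(st)/\psi(s):0<s<1,\ st<1\}$, $t>0$. If $m_\psi(t)<\infty$ for all $t>0$, the fundamental indices of $\psi$ are $\underline{\beta}_\psi=\lim_{t\to0^+}\frac{\log m_\psi(t)}{\log t}$ and $\overline{\beta}_\psi=\lim_{t\to\infty}\frac{\log m_\psi(t)}{\log t}$. $\mathcal{A}_0$ is the class of increasing positive functions $\psi:(0,1)\to(0,\infty)$ with $m_\psi<\infty$, $\psi(0^+)=0$ and $0<\underline{\beta}_\psi\le\overline{\beta}_\psi<1$. *)

(* Defs.v *)
From HB Require Import structures.
From mathcomp Require Import all_boot all_order all_algebra.
From mathcomp Require Import all_classical all_reals all_analysis.
From mathcomp Require Import measurable_realfun.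

Set Implicit Arguments.
Unset Strict Implicit.
Unset Printing Implicit Defensive.
Import Order.TTheory GRing.Theory Num.Theory.
Import numFieldNormedType.Exports.

Local Open Scope classical_set_scope.
Local Open Scope ring_scope.

(* A function on (0,1) is a total map [R -> \bar R] of which only the values
   on ]0, 1[ matter.  A function norm in the sense of Bennett and Sharpley is a
   functional on the cone [Mplus] of nonnegative measurable functions with
   values in [0, +oo]; its values off [Mplus] carry no meaning.  Measurable
   means Borel measurable, which loses nothing up to a.e. equality. *)

Definition I01 (R : realType) : set R := `]0, 1[%classic.
Arguments I01 : clear implicits.

Section rearrangement.
Context {R : realType}.
Local Open Scope ereal_scope.
Implicit Types f g : R -> \bar R.

Definition measurable01 f := measurable_fun (I01 R) f.

Definition Mplus f := measurable01 f /\ forall x, I01 R x -> 0 <= f x.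

Definition ae01 (P : R -> Prop) :=
  {ae @lebesgue_measure R, forall x, I01 R x -> P x}.

Definition int01 f : \bar R := \int[lebesgue_measure]_(x in I01 R) f x.

Definition rearrangement f (s : R) : \bar R :=
  ereal_inf [set t%:E | t in [set t : R | (0 < t)%R /\
    lebesgue_measure [set x | I01 R x /\ t%:E < `|f x|] <= s%:E]].

Definition maximal_rearrangement f (t : R) : \bar R :=
  (t^-1)%:E * \int[lebesgue_measure]_(s in `]0%R, t[%classic) rearrangement f s.

Definition abs_pow f (p : R) : R -> \bar R := fun x => `|f x| `^ p.

(* O(|f|^r, t) is [oscillation (abs_pow f r) t]. *)
Definition oscillation f (t : R) : \bar R :=
  maximal_rearrangement f t - rearrangement f t.

Definition Lpow (r : R) f := measurable01 f /\ int01 (abs_pow f r) < +oo.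

End rearrangement.

Section function_norms.
Context {R : realType}.
Local Open Scope ereal_scope.
Implicit Types (X : (R -> \bar R) -> \bar R) (f g : R -> \bar R).

Record banach_function_norm X : Prop := BanachFunctionNorm {
  bfn_ge0 : forall f, Mplus f -> 0 <= X f ;
  bfn_eq0 : forall f, Mplus f -> (X f = 0 <-> ae01 (fun x => f x = 0)) ;
  bfn_homog : forall (a : R) f, (0 <= a)%R -> Mplus f ->
    X (fun x => a%:E * f x) = a%:E * X f ;
  bfn_triangle : forall f g, Mplus f -> Mplus g ->
    X (fun x => f x + g x) <= X f + X g ;
  bfn_le : forall f g, Mplus f -> Mplus g ->
    ae01 (fun x => g x <= f x) -> X g <= X f ;
  (* Fatou property; that [X (u n)] is nondecreasing follows from [bfn_le] *)
  bfn_fatou : forall (u : nat -> R -> \bar R) f,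
    (forall n, Mplus (u n)) -> Mplus f ->
    ae01 (fun x => forall n, u n x <= u n.+1 x) ->
    ae01 (fun x => u ^~ x @ \oo --> f x) ->
    X (u n) @[n --> \oo] --> X f ;
  bfn_indic : forall E : set R, measurable E -> E `<=` I01 R ->
    X (fun x => (\1_E x)%:E) < +oo ;
  bfn_integral : forall E : set R, measurable E -> E `<=` I01 R ->
    exists2 C : R, (0 < C)%R & forall f, Mplus f ->
      \int[lebesgue_measure]_(x in E) f x <= C%:E * X f }.

Record ri_norm X : Prop := RINorm {
  ri_bfn : banach_function_norm X ;
  ri_rearrangement : forall f g, Mplus f -> Mplus g ->
    (forall s : R, I01 R s -> rearrangement f s = rearrangement g s) ->
    X f = X g }.

(* The norm, equal to +oo off the space, of a function of arbitrary sign. *)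
Definition norm_of X f : \bar R := X (fun x => `|f x|).

Definition fundamental_function X (t : R) : \bar R :=
  norm_of X (fun x => (\1_(`]0%R, t[%classic) x)%:E).

Definition associate X g : \bar R :=
  ereal_sup [set int01 (fun s => `|f s * g s|) | f in
    [set f | measurable01 f /\ norm_of X f <= 1]].

Definition convexification X (p : R) f : \bar R :=
  norm_of X (abs_pow f p) `^ p^-1.

Definition lower_estimate X (alpha : R) :=
  exists2 C : R, (0 < C)%R &
    forall (n : nat) (F : 'I_n -> R -> \bar R),
      (forall i, measurable01 (F i)) ->
      (forall i j, i != j -> forall x, I01 R x -> F i x = 0 \/ F j x = 0) ->
      (\sum_(i < n) norm_of X (F i) `^ alpha) `^ alpha^-1 <=
        C%:E * norm_of X (fun x => (\sum_(i < n) `|F i x| `^ alpha) `^ alpha^-1).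

Definition expL_norm (gamma : R) f : \bar R :=
  ereal_inf [set l%:E | l in [set l : R | (0 < l)%R /\
    int01 (fun t => expeR ((`|f t| / l%:E) `^ gamma) - 1) <= 1]].

Definition expL (gamma : R) f := measurable01 f /\ expL_norm gamma f < +oo.

End function_norms.

Section class_A0.
Context {R : realType}.
Implicit Type psi : R -> R.

Definition dilation psi (t : R) : \bar R :=
  ereal_sup [set (psi (s * t) / psi s)%:E | s in
    [set s : R | 0 < s < 1 /\ s * t < 1]].

(* For a finite dilation function both limits exist, ln (dilation psi) being
   subadditive in ln t. *)
Definition is_lower_index psi (b : R) :=
  ln (fine (dilation psi t)) / ln t @[t --> 0^'+] --> b.

Definition is_upper_index psi (b : R) :=
  ln (fine (dilation psi t)) / ln t @[t --> +oo] --> b.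

Record class_A0 psi : Prop := ClassA0 {
  A0_gt0 : forall t, I01 R t -> 0 < psi t ;
  A0_incr : forall s t, I01 R s -> I01 R t -> s <= t -> psi s <= psi t ;
  A0_dilation : forall t, 0 < t -> (dilation psi t < +oo)%E ;
  A0_at0 : psi t @[t --> 0^'+] --> (0 : R) ;
  A0_index : exists b B : R,
    [/\ is_lower_index psi b, is_upper_index psi B, 0 < b, b <= B & B < 1] }.

End class_A0.

Section quantities.
Context {R : realType}.
Local Open Scope ereal_scope.

Definition sup_ratio (X : (R -> \bar R) -> \bar R) (psi : R -> R) (t : R) :
    \bar R :=
  ereal_sup [set (psi s)%:E / fundamental_function X s | s in
    [set s : R | (t < s < 1)%R]].

Definition osc_norm (X : (R -> \bar R) -> \bar R) (psi : R -> R) (r : R)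
    (f : R -> \bar R) : \bar R :=
  norm_of X (fun t => oscillation (abs_pow f r) t `^ r^-1 / (psi t)%:E) `^ r.

End quantities.

(* Main.v *)
Require Import Defs.
From HB Require Import structures.
From mathcomp Require Import all_boot all_order all_algebra.
From mathcomp Require Import all_classical all_reals all_analysis.
From mathcomp Require Import measurable_realfun.
From mathcomp Require Import ring lra.
Import Order.TTheory GRing.Theory Num.Theory.
Import numFieldNormedType.Exports.
Local Open Scope classical_set_scope.
Local Open Scope ring_scope.

(** Write [g] for [|f|^r], [h] for its decreasing rearrangement, [F] for its
    maximal function [g**], [O = F - h] for its oscillation, and
    [w = O^(1/r) / psi], so that [A] is the [r]-th power of the norm of [w].
    The theorem follows from a growth bound, logarithmic in [1/t]: on the dyadic
    shell [2^-(n+1) <= t < 2^-n],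
      [F t - F 1 <= B * A * (n+1)^(1/beta)],   [1/beta = 1 - r/alpha].
    The power [beta] of the quotient by [A] is then at most [B^beta * (n+1)], so
    that the exponential of a multiple of it grows at most geometrically in [n],
    while the shells have measure [2^-(n+1)].  A multiple for which the
    exponential is at most [(4/3)^(n+1)] makes the integral at most
    [\sum_n (2/3)^(n+1) = 2], which serves the exponential integrals and the
    Luxemburg norm at once ([int_expeR_le]).

    The growth bound rests on two consequences of the monotonicity of [h].
    Halving the argument costs at most one oscillation,
      [F (t/2) - F t <= O t]   ([maximal_rearrangement_halving]),
    and [s * O s = \int_0^s (h - h s)] is nondecreasing in [s]
    ([oscillation_le_right]).  By the second, [O >= O t / 2] on all of
    [[t, 2t[], while [psi] there is at most [D * psi t], where [D] is its
    dilation function at 2.  So [w] is at least a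
    constant multiple of [(O t)^(1/r) / psi t] on an interval of length [t], and,
    [X] being rearrangement invariant, the norm of [w] cut to that interval is at
    least the same multiple of [(O t)^(1/r) * phi_X t / psi t].  Since
    [psi <= K * phi_X] for a bound [K] of [M], this gives
      [O t <= 2 * (D * K * || w 1_[t,2t[ ||)^r]   ([oscillation_le_cut_norm]).
    Summing over [t = 2^-(k+1)], [k < n], the lower estimate bounds the
    [l^alpha] norm of the pieces by the norm of [w], and passing from [l^alpha]
    to [l^r] over [n] terms costs the factor [n^(1 - r/alpha)] ([sum_powR_le]).

    At the right end this argument breaks down, for [h 1 = 0] makes
    [O 1 = F 1] incomparable with [A].  There [F (1/2) - F 1] is bounded by the
    integral of [O] over [[1/2, 1[] ([maximal_rearrangement_last_halving]), which
    the norm of [w] controls because [X] embeds in [L^1]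
    ([integral_oscillation_le_norm]). *)

(** * Power inequalities *)

(** A substitute for the inequalities of Jensen and Hölder which costs only a
    constant and works pointwise: below the threshold [l] the first term wins,
    above it the second.  The threshold is chosen at each use. *)
Lemma powR_interpolation (R : realType) (r p l x : R) :
  r <= p -> 0 < r -> 0 < l -> 0 <= x ->
  x `^ r <= l `^ r + l `^ (r - p) * x `^ p.
Proof.
move=> rp r0 l0 x0; have [xl|lx] := leP x l.
  apply: ler_wpDr; first by rewrite mulr_ge0 ?powR_ge0.
  by apply: ge0_ler_powR; rewrite ?nnegrE ?(ltW r0) ?(ltW l0).
have xgt0 := lt_trans l0 lx.
apply: ler_wpDl; first exact: powR_ge0.
have -> : x `^ r = x `^ (r - p) * x `^ p.
  by rewrite -powRD ?(gt_eqF xgt0) ?implybT// subrK.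
apply: ler_wpM2r; first exact: powR_ge0.
rewrite -opprB !powRN lef_pV2 ?posrE ?powR_gt0//.
by apply: ge0_ler_powR; rewrite ?nnegrE ?subr_ge0 ?(ltW l0) ?(ltW lx).
Qed.

(** Hölder's inequality up to the factor 2. *)
Lemma sum_powR_le (R : realType) (n : nat) (x : 'I_n -> R) (r p S : R) :
  r <= p -> 0 < r -> (forall i, 0 <= x i) -> 0 < S ->
  \sum_(i < n) x i `^ p <= S ->
  \sum_(i < n) x i `^ r <= 2 * S `^ (r / p) * n%:R `^ (1 - r / p).
Proof.
move=> rp r0 x0 S0 xS; have p0 := lt_le_trans r0 rp.
case: n => [|n] in x x0 xS *.
  by rewrite big_ord0 !mulr_ge0 ?powR_ge0.
have n0 : 0 < n.+1%:R :> R by rewrite ltr0n.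
(* this threshold balances the two terms of [powR_interpolation] *)
pose l := (S / n.+1%:R) `^ p^-1.
have l0 : 0 < l by rewrite powR_gt0 ?divr_gt0.
have lp : l `^ p = S / n.+1%:R.
  by rewrite -powRrM mulVf ?powRr1 ?gt_eqF ?divr_ge0 ?ltW.
have lr : n.+1%:R * l `^ r = S `^ (r / p) * n.+1%:R `^ (1 - r / p).
  rewrite -powRrM powRM ?invr_ge0 ?ltW// [p^-1 * r]mulrC mulrCA; congr (_ * _).
  rewrite powRD ?(gt_eqF n0) ?implybT// powRr1 ?ltW//.
  by rewrite -(powR_inv1 (ltW n0)) -powRrM mulN1r.
apply: (@le_trans _ _ (\sum_(i < n.+1) (l `^ r + l `^ (r - p) * x i `^ p))).
  by apply: ler_sum => i _; exact: powR_interpolation.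
rewrite big_split /= sumr_const card_ord -mulr_sumr -[_ `^ r *+ _]mulr_natl.
have -> : 2 * S `^ (r / p) * n.+1%:R `^ (1 - r / p) =
    n.+1%:R * l `^ r + n.+1%:R * l `^ r by rewrite lr; ring.
rewrite lerD2l (le_trans (ler_wpM2l (powR_ge0 _ _) xS))//.
have -> : l `^ r = l `^ (r - p) * l `^ p.
  by rewrite -powRD ?(gt_eqF l0) ?implybT// subrK.
by rewrite lp mulrCA [_ * (S / _)]mulrC divfK ?gt_eqF// mulrC.
Qed.

(** * Averages of a nonincreasing function *)

(** The only trace of [P t = \int_0^t h], with [h] nonincreasing, that the
    estimates on averages use: [h] is a supergradient of [P], and the line
    through the origin of slope [h s] stays below [P] at [s]. *)
Section concave_primitive.
Context {R : realType}.
Variables h P : R -> R.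
Hypothesis hP : forall s t : R, 0 < s -> s <= t -> t <= 1 ->
  (t - s) * h t <= P t - P s <= (t - s) * h s.
Hypothesis hP0 : forall s : R, 0 < s -> s <= 1 -> s * h s <= P s.

Lemma average_nonincreasing (s t : R) : 0 < s -> s <= t -> t <= 1 ->
  t^-1 * P t <= s^-1 * P s.
Proof.
move=> s0 st t1; have t0 := lt_le_trans s0 st.
have /andP[_ Pst] := hP _ _ s0 st t1; have Ps := hP0 _ s0 (le_trans st t1).
rewrite -subr_ge0.
have -> : s^-1 * P s - t^-1 * P t = (t * P s - s * P t) / (s * t).
  by field; rewrite !gt_eqF.
rewrite divr_ge0 ?mulr_ge0 ?(ltW s0) ?(ltW t0)//.
have : (t - s) * (s * h s) <= (t - s) * P s.
  by rewrite ler_wpM2l ?subr_ge0.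
have : s * (P t - P s) <= s * ((t - s) * h s) by rewrite ler_wpM2l ?(ltW s0).
lra.
Qed.

Lemma gap_nondecreasing (s t : R) : 0 < s -> s <= t -> t <= 1 ->
  P s - s * h s <= P t - t * h t.
Proof.
move=> s0 st t1; have /andP[P1 P2] := hP _ _ s0 st t1.
have : s * ((t - s) * h t) <= s * ((t - s) * h s).
  by rewrite ler_wpM2l ?(ltW s0)// (le_trans P1).
have [<-//|nst] := eqVneq s t.
have ts : 0 < t - s by rewrite subr_gt0 lt_neqAle nst.
rewrite ler_pM2l// ler_pM2l// => hts.
have : s * h t <= s * h s by rewrite ler_wpM2l ?(ltW s0).
lra.
Qed.

Lemma average_halving (t : R) : 0 < t -> t <= 1 ->
  (t / 2)^-1 * P (t / 2) - t^-1 * P t <= t^-1 * P t - h t.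
Proof.
move=> t0 t1; have /andP[P1 _] : _ && _ := @hP (t / 2) t ltac:(lra) ltac:(lra) t1.
rewrite -(ler_pM2l t0).
have -> : t * ((t / 2)^-1 * P (t / 2) - t^-1 * P t) = 2 * P (t / 2) - P t.
  by field; rewrite gt_eqF.
have -> : t * (t^-1 * P t - h t) = P t - t * h t by field; rewrite gt_eqF.
have e : t - t / 2 = t / 2 by lra.
rewrite e in P1; lra.
Qed.

End concave_primitive.

(** * Rearrangements *)

Lemma nonincreasing_emeasurable (R : realType) (D : set R) (f : R -> \bar R) :
  is_interval D ->
  (forall x y, D x -> D y -> x <= y -> (f y <= f x)%E) -> measurable_fun D f.
Proof.
move=> iD f_ni.
apply: (measurability (@ErealGenCInfty.G R)) => [|_ [_] [a ->] <-].
  exact: ErealGenCInfty.measurableE.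
apply: is_interval_measurable => x y /= [Dx fx] [Dy fy] z /andP[xz zy].
have Dz : D z by apply: (iD x y) => //; rewrite xz.
split=> //; move: fy; rewrite /= !in_itv/= !andbT => /le_trans; apply.
exact: f_ni.
Qed.

Section rearrangement_facts.
Context {R : realType}.
Local Open Scope ereal_scope.
Implicit Types (f : R -> \bar R) (E F : set R) (s t : R).
Let mu := @lebesgue_measure R.

Lemma rearrangement_ge0 f s : 0 <= rearrangement f s.
Proof.
by apply: le_ereal_inf_tmp => _ [t [t0 _] <-]; rewrite lee_fin ltW.
Qed.

Lemma rearrangement_le f s t : (s <= t)%R ->
  rearrangement f t <= rearrangement f s.
Proof.
move=> st; apply: ereal_inf_le_tmp => _ [l [l0 fl] <-]; exists l => //.
by split=> //; rewrite (le_trans fl)// lee_fin.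
Qed.

Lemma measurable_rearrangement f (D : set R) : is_interval D ->
  measurable_fun D (rearrangement f).
Proof.
by move=> iD; apply: nonincreasing_emeasurable => // *; exact: rearrangement_le.
Qed.

(** Markov's inequality: the level [(\int |f| + 1) / s] is exceeded on a set of
    measure less than [s]. *)
Lemma rearrangement_fin_num f s : measurable01 f -> int01 (abse \o f) < +oo ->
  (0 < s)%R -> rearrangement f s \is a fin_num.
Proof.
move=> mf fi s0; rewrite ge0_fin_numE ?rearrangement_ge0//.
have i0 : 0 <= int01 (abse \o f) by apply: integral_ge0 => x _ /=.
have ifin : int01 (abse \o f) \is a fin_num by rewrite ge0_fin_numE.
pose l : R := ((fine (int01 (abse \o f)) + 1) / s)%R.
have l0 : (0 < l)%R by rewrite divr_gt0// ltr_wpDl// fine_ge0.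
apply: (@le_lt_trans _ _ l%:E); last exact: ltry.
apply: ereal_inf_lbound; exists l => //; split=> //.
have := @le_integral_comp_abse _ _ R mu (I01 R) (measurable_itv _) f l id
  (@measurable_id _ _ _) (fun _ h => h) (fun _ _ _ _ h => h) mf l0.
have mE : measurable (I01 R `&` [set x | l%:E <= `|f x|]).
  apply: emeasurable_fun_c_infty; first exact: measurable_itv.
  exact: measurableT_comp.
have mF : measurable (I01 R `&` [set x | l%:E < `|f x|]).
  apply: emeasurable_fun_o_infty; first exact: measurable_itv.
  exact: measurableT_comp.
move=> h.
have : l%:E * mu [set x | I01 R x /\ l%:E < `|f x|] <= int01 (abse \o f).
  apply: le_trans h; apply: lee_wpmul2l; first by rewrite lee_fin ltW.
  by apply: le_measure; rewrite ?inE// => x [? /ltW].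
rewrite -lee_pdivlMl// => /le_trans; apply.
rewrite -(fineK ifin) -EFinM lee_fin /l invf_div mulrAC.
by rewrite ler_pdivrMr ?ltr_wpDl ?fine_ge0// ler_pM2l// lerDl.
Qed.

Lemma eq_rearrangement_indic E F s : E `<=` I01 R -> F `<=` I01 R ->
  mu E = mu F ->
  rearrangement (fun x => (\1_E x)%:E) s =
  rearrangement (fun x => (\1_F x)%:E) s.
Proof.
(* the superlevel sets of an indicator: the set itself below 1, then empty *)
have level (A : set R) (l : R) : A `<=` I01 R -> (0 < l)%R ->
    [set x | I01 R x /\ l%:E < `|(\1_A x)%:E|] = if (l < 1)%R then A else set0.
  move=> AI l0; apply/seteqP; split=> x /=.
    move=> [_]; rewrite lte_fin indicE.
    case: (boolP (x \in A)) => [/set_mem Ax|_].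
      by rewrite normr1 => ->.
    by rewrite normr0 ltNge (ltW l0).
  case: ifP => // l1 Ax; split; first exact: AI.
  by rewrite indicE mem_set// lte_fin normr1.
move=> EI FI EF; congr ereal_inf; apply/seteqP; split=> _ [l [l0 h] <-];
  exists l => //; split=> //; move: h; rewrite !level//; case: ifP => // _.
  by rewrite -/mu EF.
by rewrite -/mu EF.
Qed.

Lemma integral_itv0_split (g : R -> \bar R) s t : (0 < s)%R -> (s <= t)%R ->
  measurable_fun `]0%R, t[%classic g ->
  (forall x : R, (0 < x < t)%R -> 0 <= g x) ->
  \int[mu]_(x in `]0%R, t[%classic) g x =
  \int[mu]_(x in `]0%R, s[%classic) g x + \int[mu]_(x in `[s, t[%classic) g x.
Proof.
move=> s0 st mg g0.
have e : `]0%R, t[%classic = `]0%R, s[%classic `|` `[s, t[%classic :> set R.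
  by rewrite -itv_bndbnd_setU// bnd_simp.
rewrite [in LHS]e ge0_integral_setU//= -?e//.
  move=> x xst; apply: g0.
  have : (`]0%R, s[%classic `|` `[s, t[%classic) x := xst.
  by rewrite -e /= in_itv.
apply/disj_setPS => x /= []; rewrite !in_itv/= => /andP[_ xs] /andP[sx _].
by move: xs; rewrite ltNge sx.
Qed.

Lemma integral_cst_itv (c : \bar R) s t : (s <= t)%R ->
  \int[mu]_(x in `[s, t[%classic) (cst c x) = (t - s)%:E * c.
Proof.
move=> st; rewrite integral_cst//= lebesgue_measure_itv/= lte_fin.
rewrite muleC; case: ltP => [_|ts]; first by rewrite EFinB.
have -> : s = t by apply/le_anti; rewrite st ts.
by rewrite subrr.
Qed.

End rearrangement_facts.

Section primitive_of_rearrangement.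
Context {R : realType}.
Local Open Scope ereal_scope.
Implicit Types (f : R -> \bar R) (s t : R).
Let mu := @lebesgue_measure R.

Lemma integral_rearrangement_bounds f s t : (0 < s)%R -> (s <= t)%R ->
  (t - s)%:E * rearrangement f t <=
    \int[mu]_(x in `[s, t[%classic) rearrangement f x <=
  (t - s)%:E * rearrangement f s.
Proof.
move=> s0 st; rewrite -!integral_cst_itv//; apply/andP; split.
  apply: ge0_le_integral => //=.
  - by move=> x _; exact: rearrangement_ge0.
  - exact: measurable_rearrangement (@interval_is_interval _ _).
  - by move=> x; rewrite in_itv/= => /andP[_ /ltW]; exact: rearrangement_le.
apply: ge0_le_integral => //=.
- by move=> x _; exact: rearrangement_ge0.
- exact: measurable_rearrangement (@interval_is_interval _ _).
- by move=> x; rewrite in_itv/= => /andP[+ _]; exact: rearrangement_le.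
Qed.

End primitive_of_rearrangement.

(** * The maximal function and the oscillation *)

Section finite_primitive.
Context {R : realType}.
Local Open Scope ereal_scope.
Variable g : R -> \bar R.
Hypothesis g_fin : forall s : R, (0 < s)%R -> rearrangement g s \is a fin_num.
Let mu := @lebesgue_measure R.
Let I (t : R) := \int[mu]_(s in `]0%R, t[%classic) rearrangement g s.
Let h (s : R) := fine (rearrangement g s).
Let P (t : R) := fine (I t).

Let hE (s : R) : (0 < s)%R -> rearrangement g s = (h s)%:E.
Proof. by move=> s0; rewrite fineK// g_fin. Qed.

Lemma int_rearrangement_split (s t : R) : (0 < s)%R -> (s <= t)%R ->
  I t = I s + \int[mu]_(x in `[s, t[%classic) rearrangement g x.
Proof.
move=> s0 st; apply: integral_itv0_split => //.
- exact: measurable_rearrangement (@interval_is_interval _ _).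
- by move=> x _; exact: rearrangement_ge0.
Qed.

Lemma int_rearrangement_ge0 (t : R) : 0 <= I t.
Proof. by apply: integral_ge0 => x _; exact: rearrangement_ge0. Qed.

(** If [h] is finite but not integrable at [0], then [F] is infinite everywhere,
    and so is [F - h].  One finite value of the oscillation therefore makes [F]
    finite. *)
Lemma int_rearrangement_lty (t0 : R) : (0 < t0 < 1)%R ->
  oscillation g t0 < +oo -> I 1%R < +oo.
Proof.
move=> /andP[t00 t01] ofin.
have It0 : I t0 < +oo.
  rewrite ltey; apply/negP => /eqP It0; move: ofin.
  rewrite /oscillation /maximal_rearrangement -/mu -/(I t0) It0 hE//.
  by rewrite gt0_muley ?lte_fin ?invr_gt0// addye// ltxx.
rewrite (@int_rearrangement_split t0)// ?(ltW t01)//.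
apply: lte_add_pinfty => //.
have /andP[_] := @integral_rearrangement_bounds R g t0 1%R t00 (ltW t01).
by move=> /le_lt_trans; apply; rewrite hE// -EFinM ltry.
Qed.

Hypothesis I1_fin : I 1%R < +oo.

Lemma int_rearrangementE (t : R) : (0 < t)%R -> (t <= 1)%R -> I t = (P t)%:E.
Proof.
move=> t0 t1; rewrite fineK// ge0_fin_numE ?int_rearrangement_ge0//.
apply: le_lt_trans I1_fin; rewrite (int_rearrangement_split _ _ t0 t1) leeDl//.
by apply: integral_ge0 => x _; exact: rearrangement_ge0.
Qed.

Lemma primitive_bounds (s t : R) : (0 < s)%R -> (s <= t)%R -> (t <= 1)%R ->
  ((t - s) * h t <= P t - P s <= (t - s) * h s)%R.
Proof.
move=> s0 st t1; have t0 := lt_le_trans s0 st.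
have := @integral_rearrangement_bounds R g s t s0 st.
have -> : \int[lebesgue_measure]_(x in `[s, t[) rearrangement g x =
    (P t - P s)%:E.
  rewrite EFinB -!int_rearrangementE// ?(le_trans st)//.
  rewrite (int_rearrangement_split _ _ s0 st) [I s + _]addeC addeK//.
  by rewrite int_rearrangementE// (le_trans st).
by rewrite !hE// -!EFinM !lee_fin.
Qed.

Lemma primitive_ge (s : R) : (0 < s)%R -> (s <= 1)%R -> (s * h s <= P s)%R.
Proof.
move=> s0 s1; rewrite -lee_fin -int_rearrangementE// EFinM -hE//.
have -> : s%:E * rearrangement g s =
    \int[mu]_(x in `]0%R, s[%classic) (cst (rearrangement g s) x).
  rewrite integral_cst//= /mu lebesgue_measure_itv/= lte_fin s0.
  by rewrite oppr0 adde0 muleC.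
apply: ge0_le_integral => //=.
- by move=> x _; exact: rearrangement_ge0.
- exact: measurable_rearrangement (@interval_is_interval _ _).
- by move=> x; rewrite in_itv/= => /andP[_ /ltW]; exact: rearrangement_le.
Qed.

Lemma maximal_rearrangementE (t : R) : (0 < t)%R -> (t <= 1)%R ->
  maximal_rearrangement g t = (t^-1 * P t)%:E.
Proof.
by move=> t0 t1; rewrite /maximal_rearrangement -/mu -/(I t) int_rearrangementE.
Qed.

Lemma oscillationE (t : R) : (0 < t)%R -> (t <= 1)%R ->
  oscillation g t = (t^-1 * P t - h t)%:E.
Proof. by move=> t0 t1; rewrite /oscillation maximal_rearrangementE// hE. Qed.

Lemma oscillation_ge0 (t : R) : (0 < t)%R -> (t <= 1)%R -> 0 <= oscillation g t.
Proof.
move=> t0 t1; rewrite oscillationE// lee_fin subr_ge0 mulrC.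
by rewrite ler_pdivlMr// mulrC primitive_ge.
Qed.

Lemma maximal_rearrangement_nonincreasing (s t : R) :
  (0 < s)%R -> (s <= t)%R -> (t <= 1)%R ->
  maximal_rearrangement g t <= maximal_rearrangement g s.
Proof.
move=> s0 st t1; have t0 := lt_le_trans s0 st; have s1 := le_trans st t1.
rewrite !maximal_rearrangementE// lee_fin.
exact: (average_nonincreasing h P primitive_bounds primitive_ge).
Qed.

(** [t * O t] is the area between [h] and the level [h t] over [(0, t)], which
    grows with [t]. *)
Lemma oscillation_le_right (s t : R) : (0 < s)%R -> (s <= t)%R -> (t <= 1)%R ->
  s%:E * oscillation g s <= t%:E * oscillation g t.
Proof.
move=> s0 st t1; have t0 := lt_le_trans s0 st; have s1 := le_trans st t1.
rewrite !oscillationE// -!EFinM lee_fin.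
rewrite !mulrBr !mulrA !divff ?gt_eqF// !mul1r.
exact: (gap_nondecreasing h P primitive_bounds).
Qed.

(** [t * (F (t/2) - F t)] is the integral of [h] over the left half of [(0, t)]
    minus that over the right half; subtracting the level [h t] from [h] leaves
    this difference unchanged and makes both integrals nonnegative, with sum
    [t * O t]. *)
Lemma maximal_rearrangement_halving (t : R) : (0 < t)%R -> (t <= 1)%R ->
  maximal_rearrangement g (t / 2) - maximal_rearrangement g t <=
  oscillation g t.
Proof.
move=> t0 t1; have t20 : (0 < t / 2)%R by rewrite divr_gt0.
have t21 : (t / 2 <= 1)%R by lra.
rewrite !maximal_rearrangementE// oscillationE// lee_fin.
exact: (average_halving h P primitive_bounds).
Qed.

Lemma measurable_maximal_rearrangement : measurable01 (maximal_rearrangement g).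
Proof.
apply: nonincreasing_emeasurable; first exact: interval_is_interval.
move=> x y; rewrite /I01/= !in_itv/= => /andP[x0 _] /andP[_ y1] xy.
exact: maximal_rearrangement_nonincreasing _ _ x0 xy (ltW y1).
Qed.

Lemma measurable_oscillation : measurable01 (oscillation g).
Proof.
apply: emeasurable_funB; first exact: measurable_maximal_rearrangement.
exact: measurable_rearrangement (@interval_is_interval _ _).
Qed.

(** The substitute for [maximal_rearrangement_halving] at [t = 1], where the
    value [O 1] is useless: for [s] in [[1/2, 1[],
    [O s >= s * O s >= \int_0^(1/2) h - h s / 2], and averaging over [s]
    recovers the difference of the two half integrals. *)
Lemma maximal_rearrangement_last_halving :
  maximal_rearrangement g (2^-1)%R - maximal_rearrangement g 1%R <=
  2%:E * \int[mu]_(s in `[(2^-1)%R, 1%R[%classic) oscillation g s.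
Proof.
have h0 : (0 < 2^-1 :> R)%R by rewrite invr_gt0.
have h1 : (2^-1 <= 1 :> R)%R by lra.
have hh s : (0 < s)%R -> (0 <= h s)%R.
  by move=> s0; apply: fine_ge0; exact: rearrangement_ge0.
pose D : set R := `[(2^-1)%R, 1%R[%classic.
have mD : measurable D by exact: measurable_itv.
have sub : D `<=` I01 R.
  move=> x; rewrite /D /I01/= !in_itv/= => /andP[x0 ->].
  by rewrite (lt_le_trans h0).
have pos (x : R) : D x -> 0 <= oscillation g x.
  move=> xI; have := sub x xI; rewrite /I01/= in_itv/= => /andP[x0 x1].
  by rewrite oscillation_ge0 ?(ltW x1).
have mO : measurable_fun D (oscillation g).
  by apply: measurable_funS measurable_oscillation => //; exact: measurable_itv.
have mh : measurable_fun D (rearrangement g).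
  exact: measurable_rearrangement (@interval_is_interval _ _).
have key : \int[mu]_(s in D) (cst (P (2^-1)%R)%:E s) <=
    \int[mu]_(s in D)
      (oscillation g s + (2^-1)%:E * rearrangement g s).
  apply: ge0_le_integral => //=.
  - move=> x xI; rewrite lee_fin; apply: le_trans (primitive_ge _ h0 h1).
    by rewrite mulr_ge0 ?hh// ltW.
  - by apply: emeasurable_funD => //; exact: measurable_funeM.
  - move=> x xI; have := sub x xI; rewrite /I01/= in_itv/= => /andP[x0 x1].
    rewrite oscillationE ?(ltW x1)// hE// -EFinM -EFinD lee_fin.
    have hx : (2^-1 <= x)%R by move: xI; rewrite /D/= in_itv/= => /andP[].
    have /andP[Ph _] := primitive_bounds _ _ h0 hx (ltW x1).
    have Px := primitive_ge _ x0 (ltW x1).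
    have : (P x - x * h x <= x^-1 * (P x - x * h x))%R.
      by rewrite ler_peMl ?subr_ge0// invf_ge1// ltW.
    rewrite mulrBr mulrA mulVf ?gt_eqF// mul1r; lra.
move: key; rewrite integral_cst_itv// ge0_integralD//; last 2 first.
- by move=> x _; rewrite mule_ge0 ?lee_fin ?rearrangement_ge0// ltW.
- exact: measurable_funeM.
rewrite ge0_integralZl//=; last by move=> x _; exact: rearrangement_ge0.
have -> : \int[mu]_(x in D) rearrangement g x = (P 1 - P 2^-1)%R%:E.
  rewrite EFinB -!int_rearrangementE//.
  rewrite (int_rearrangement_split _ _ h0 h1) [I (2^-1)%R + _]addeC addeK//.
  by rewrite int_rearrangementE.
rewrite -/D !maximal_rearrangementE// -!EFinM -EFinB.
have : 0 <= \int[mu]_(x in D) oscillation g x by exact: integral_ge0.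
case: (\int[mu]_(x in _) _) => [x _| _ _ |//]; last first.
  by rewrite gt0_muley ?lte_fin// leey.
rewrite -EFinD -EFinM !lee_fin invrK invr1; lra.
Qed.

End finite_primitive.

(** * Function norms and weights *)

Lemma measurable_I01 (R : realType) : measurable (I01 R).
Proof. exact: measurable_itv. Qed.

Lemma class_A0_doubling (R : realType) (psi : R -> R) : class_A0 psi ->
  exists2 D : R, 0 < D & forall s : R, 0 < s < 1 -> psi s <= D * psi (s / 2).
Proof.
move=> hpsi; have dfin := A0_dilation hpsi (@ltr0Sn R 1).
have ub (s : R) : 0 < s < 1 -> ((psi s / psi (s / 2))%:E <= dilation psi 2)%E.
  move=> s01; apply: ereal_sup_ubound; exists (s / 2); last by rewrite divfK.
  by rewrite /= divfK//; move: s01 => /andP[s0 s1]; split; [lra|].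
have psi0 (s : R) : 0 < s < 1 -> 0 < psi s.
  by move=> s01; apply: (A0_gt0 hpsi); rewrite /I01/= in_itv.
have half (s : R) : 0 < s < 1 -> 0 < s / 2 < 1 by move=> /andP[s0 s1]; lra.
have d0 : (0 < dilation psi 2)%E.
  have h01 : 0 < (2^-1 : R) < 1 by lra.
  by apply: lt_le_trans (ub _ h01); rewrite lte_fin divr_gt0 ?psi0 ?half.
exists (fine (dilation psi 2)); first by rewrite fine_gt0// d0.
move=> s s01; rewrite -ler_pdivrMr ?psi0 ?half// -lee_fin fineK ?ub//.
by rewrite ge0_fin_numE// ltW.
Qed.

Section norm_facts.
Context {R : realType}.
Local Open Scope ereal_scope.
Variable X : (R -> \bar R) -> \bar R.
Implicit Types (w : R -> \bar R) (E : set R).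
Let mu := @lebesgue_measure R.

Lemma Mplus_indic E : measurable E -> Mplus (fun x => (\1_E x)%:E).
Proof.
move=> mE; split=> [|x _]; last by rewrite lee_fin.
by apply: measurable_funTS; apply/measurable_EFinP; exact: measurable_indic.
Qed.

Lemma Mplus_cut w E : measurable E -> Mplus w ->
  Mplus (fun x => w x * (\1_E x)%:E).
Proof.
move=> mE [mw w0]; have [m1 _] := Mplus_indic _ mE; split=> [|x Ix].
  exact: emeasurable_funM.
by rewrite mule_ge0 ?w0// lee_fin.
Qed.

Lemma le_norm_pointwise w1 w2 : banach_function_norm X ->
  Mplus w1 -> Mplus w2 -> (forall x, I01 R x -> w1 x <= w2 x) -> X w1 <= X w2.
Proof. by move=> hX M1 M2 h; apply: bfn_le => //; exact: aeW. Qed.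

Lemma norm_indic_gt0 E : banach_function_norm X -> measurable E ->
  E `<=` I01 R -> mu E != 0 -> 0 < X (fun x => (\1_E x)%:E).
Proof.
move=> hX mE EI muE; have M := Mplus_indic _ mE.
rewrite lt0e (bfn_ge0 hX)// andbT; apply: contra muE => /eqP.
move/(bfn_eq0 hX M) => [N [mN N0 sub]].
rewrite -measure_le0 -N0; apply: le_measure; rewrite ?inE// => x Ex.
apply: sub => /= /(_ (EI _ Ex)) /eqP.
by rewrite indicE mem_set// eqe oner_eq0.
Qed.

(** Rearrangement invariance lets any set of measure [t] compute the fundamental
    function at [t]; the dyadic shells are used instead of [(0, t)]. *)
Lemma fundamental_functionE E (t : R) : ri_norm X -> measurable E ->
  E `<=` I01 R -> (0 < t <= 1)%R -> mu E = t%:E ->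
  fundamental_function X t = X (fun x => (\1_E x)%:E).
Proof.
move=> hX mE EI /andP[t0 t1] muE; rewrite /fundamental_function /norm_of.
rewrite (_ : (fun x => _) = (fun x => (\1_(`]0%R, t[%classic) x)%:E)); last first.
  by apply/funext => x; rewrite gee0_abs// lee_fin.
apply: (ri_rearrangement hX); [exact: Mplus_indic | exact: Mplus_indic |].
move=> s _; apply: eq_rearrangement_indic => //.
  move=> x; rewrite /I01/= !in_itv/= => /andP[-> /lt_le_trans]; exact.
by rewrite lebesgue_measure_itv/= lte_fin t0 oppr0 adde0.
Qed.

Lemma fundamental_function_gt0_fin (t : R) : ri_norm X -> (0 < t < 1)%R ->
  exists2 p : R, (0 < p)%R & fundamental_function X t = p%:E.
Proof.
move=> hX /andP[t0 t1].
have sub : `]0%R, t[%classic `<=` I01 R.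
  by move=> x; rewrite /I01/= !in_itv/= => /andP[-> /lt_trans]; exact.
have mt : measurable (`]0%R, t[%classic : set R) by exact: measurable_itv.
have mut : mu `]0%R, t[%classic = t%:E.
  by rewrite /mu lebesgue_measure_itv/= lte_fin t0 oppr0 adde0.
rewrite (fundamental_functionE _ _ hX mt sub)// ?t0 ?ltW//.
have lt := bfn_indic (ri_bfn hX) mt sub.
have gt : 0 < X (fun x => (\1_(`]0%R, t[%classic) x)%:E).
  by apply: norm_indic_gt0 => //; [exact: ri_bfn | rewrite mut eqe gt_eqF].
case: (X _) lt gt => [p _|//|//]; rewrite lte_fin => p0; by exists p.
Qed.

Lemma sup_ratio_bound (psi : R -> R) (K t : R) :
  ri_norm X -> (0 < t < 1)%R ->
  (forall t, I01 R t -> sup_ratio X psi t <= K%:E) ->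
  (psi t)%:E <= K%:E * fundamental_function X t.
Proof.
move=> hX t01 hM; have [p p0 pE] := fundamental_function_gt0_fin _ hX t01.
move: t01 => /andP[t0 t1].
have I2 : I01 R (t / 2)%R by rewrite /I01/= in_itv/=; lra.
have : (psi t)%:E / fundamental_function X t <= K%:E.
  apply: le_trans (hM _ I2); apply: ereal_sup_ubound; exists t => //=.
  by rewrite t1 andbT; lra.
by rewrite pE inver gt_eqF// -!EFinM !lee_fin ler_pdivrMr.
Qed.

End norm_facts.

(** * Dyadic shells *)

Definition dyadic_shell {R : realType} (n : nat) : set R :=
  `[2^-1 ^+ n.+1, 2^-1 ^+ n[%classic.

Section dyadic_shells.
Context {R : realType}.
Let shell : nat -> set R := @dyadic_shell R.

Lemma measurable_dyadic_shell n : measurable (shell n).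
Proof. exact: measurable_itv. Qed.

Lemma dyadic_shell_exists (t : R) : (0 < t < 1)%R ->
  exists n : nat, (2^-1 ^+ n.+1 <= t < 2^-1 ^+ n)%R.
Proof.
move=> /andP[t0 t1].
have ex : exists n : nat, (2^-1 ^+ n <= t)%R.
  exists (Num.truncn t^-1).+1.
  rewrite exprVn -[leRHS]invrK lef_pV2 ?posrE ?invr_gt0//.
  rewrite ltW// (lt_le_trans (truncnS_gt _))// -natrX ler_nat.
  by apply: ltnW; exact: ltn_expl.
have := ex_minnP ex; case=> -[|n] tn min.
  by move: tn; rewrite expr0 leNgt t1.
by exists n; rewrite tn ltNge; apply/negP => /min; rewrite ltnn.
Qed.

Lemma trivIset_dyadic_shell : trivIset setT shell.
Proof.
have le_half i j : (i < j)%N -> (2^-1 ^+ j <= 2^-1 ^+ i.+1 :> R)%R.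
  by move=> ij; apply: ler_wiXn2l; rewrite ?invr_ge0 ?invf_le1 ?ler1n.
move=> i j _ _ [x []]; rewrite /shell /dyadic_shell/= !in_itv/=.
move=> /andP[i1 i2] /andP[j1 j2].
case: (ltngtP i j) => // /le_half h.
  by have := lt_le_trans j2 (le_trans h i1); rewrite ltxx.
by have := lt_le_trans i2 (le_trans h j1); rewrite ltxx.
Qed.

Lemma bigcup_dyadic_shell : \bigcup_n shell n = I01 R.
Proof.
apply/seteqP; split=> x.
  move=> [n _]; rewrite /shell /dyadic_shell /I01/= !in_itv/= => /andP[xn nx].
  rewrite (lt_le_trans _ xn) ?exprn_gt0 ?invr_gt0// (lt_le_trans nx)//.
  by rewrite exprn_ile1// ?invr_ge0// invf_le1// ler1n.
rewrite /I01/= in_itv/= => /dyadic_shell_exists[n nx]; exists n => //.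
Qed.

End dyadic_shells.

(** * The pieces of a function under a lower estimate *)

Definition lower_estimate_with {R : realType} (X : (R -> \bar R) -> \bar R)
    (alpha C : R) : Prop :=
  forall (n : nat) (F : 'I_n -> R -> \bar R),
    (forall i, measurable01 (F i)) ->
    (forall i j, i != j -> forall x, I01 R x -> F i x = 0%E \/ F j x = 0%E) ->
    ((\sum_(i < n) norm_of X (F i) `^ alpha) `^ alpha^-1 <=
      C%:E * norm_of X (fun x => (\sum_(i < n) `|F i x| `^ alpha) `^ alpha^-1))%E.

Section lower_estimate_pieces.
Context {R : realType}.
Local Open Scope ereal_scope.
Variable X : (R -> \bar R) -> \bar R.

(** The [alpha]-sum of the pieces of [w] is pointwise at most [w]: at each point
    at most one piece differs from 0. *)
Lemma lower_estimate_cut (alpha C b : R) (w : R -> \bar R) (E : nat -> set R)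
    (n : nat) : banach_function_norm X -> (0 < alpha)%R -> (0 < C)%R ->
  lower_estimate_with X alpha C ->
  (forall i, measurable (E i)) -> trivIset setT E ->
  Mplus w -> (0 <= b)%R -> X w <= b%:E ->
  \sum_(i < n) X (fun x => w x * (\1_(E i) x)%:E) `^ alpha <=
    ((C * b) `^ alpha)%:E.
Proof.
move=> hX a0 C0 hlow mE tE Mw b0 wb; have [mw w0] := Mw.
pose F (i : 'I_n) x := w x * (\1_(E i) x)%:E.
have MF i : Mplus (F i) by exact: Mplus_cut.
have F_eq0 (i : nat) (x : R) : ~ E i x -> w x * (\1_(E i) x)%:E = 0.
  by move=> nEx; rewrite indicE memNset// mule0.
have F_eqw (i : nat) (x : R) : E i x -> w x * (\1_(E i) x)%:E = w x.
  by move=> Ex; rewrite indicE mem_set// mule1.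
have dis (i j : 'I_n) (x : R) : i != j -> E i x -> ~ E j x.
  move=> ij Ei Ej; move/eqP : ij; apply; apply: val_inj.
  by apply: (tE i j) => //; exists x.
have XF i : norm_of X (F i) = X (F i).
  apply/le_anti/andP; split; apply: (le_norm_pointwise _ _ _ hX) => //.
  - split=> [|x Ix]; last exact: abse_ge0.
    by apply: measurableT_comp => //; exact: (MF i).1.
  - by move=> x Ix; rewrite gee0_abs// (MF i).2.
  - split=> [|x Ix]; last exact: abse_ge0.
    by apply: measurableT_comp => //; exact: (MF i).1.
  - by move=> x Ix; rewrite gee0_abs// (MF i).2.
have := hlow n F (fun i => (MF i).1).
have disF i j : i != j -> forall x, I01 R x -> F i x = 0 \/ F j x = 0.
  move=> ij x _; have [Ei|nEi] := pselect (E i x); last by left; exact: F_eq0.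
  by right; apply: F_eq0; exact: dis Ei.
move=> /(_ disF).
set S := \sum_(i < n) _; set G := fun x : R => _.
have -> : \sum_(i < n) X (fun x => w x * (\1_(E i) x)%:E) `^ alpha = S.
  by apply: eq_bigr => i _; rewrite -XF.
have S0 : 0 <= S by apply: sume_ge0 => i _; exact: poweR_ge0.
have Gw (x : R) : I01 R x -> `|G x| <= w x.
  move=> Ix; rewrite gee0_abs ?poweR_ge0// /G.
  have [[j Ej]|nE] := pselect (exists j : 'I_n, E j x).
    rewrite (bigD1 j)//= big1 ?adde0; last first.
      move=> i ij; rewrite /F F_eq0 ?abse0 ?poweR0r ?gt_eqF//.
      by move=> Ei; exact: dis ij Ei Ej.
    rewrite /F F_eqw// gee0_abs ?w0// -poweRrM divff ?gt_eqF// poweRe1// w0//.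
  rewrite big1 ?poweR0r ?w0// ?invr_neq0 ?gt_eqF// => i _.
  rewrite /F F_eq0 ?abse0 ?poweR0r ?gt_eqF// => Ei; apply: nE; by exists i.
have MG : Mplus (fun x => `|G x|).
  split=> [|x _]; last exact: abse_ge0.
  apply: measurableT_comp => //; rewrite /G.
  apply: (measurableT_comp (measurable_poweR _)).
  apply: emeasurable_sum => i; apply: (measurableT_comp (measurable_poweR _)).
  by apply: measurableT_comp => //; exact: (MF i).1.
move=> h; have {h} : S `^ alpha^-1 <= (C * b)%:E.
  apply: (le_trans h); rewrite EFinM lee_wpmul2l ?lee_fin ?(ltW C0)//.
  by apply: le_trans wb; exact: le_norm_pointwise.
have Cb0 : (0 <= C * b)%R by rewrite mulr_ge0 ?(ltW C0).
move=> h; have : (S `^ alpha^-1) `^ alpha <= (C * b)%:E `^ alpha.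
  apply: gt0_ler_poweR h; first exact: ltW.
    by rewrite in_itv/= poweR_ge0 leey.
  by rewrite in_itv/= lee_fin Cb0 leey.
by rewrite -poweRrM mulVf ?gt_eqF// poweRe1// poweR_EFin.
Qed.

End lower_estimate_pieces.

(** * The weighted oscillation *)

(** The function whose norm defines [osc_norm]; the absolute value is the one in
    [norm_of]. *)
Definition weighted_oscillation {R : realType} (psi : R -> R) (r : R)
    (g : R -> \bar R) : R -> \bar R :=
  fun t => (`|oscillation g t `^ r^-1 / (psi t)%:E|)%E.

Section weighted_oscillation_bounds.
Context {R : realType}.
Local Open Scope ereal_scope.
Variables (X : (R -> \bar R) -> \bar R) (psi : R -> R) (r D K : R).
Hypotheses (hX : ri_norm X) (hpsi : class_A0 psi) (hr : (0 < r <= 1)%R).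
Hypotheses (D0 : (0 < D)%R)
  (psiD : forall s : R, (0 < s < 1)%R -> (psi s <= D * psi (s / 2))%R).
Hypothesis psiK : forall t : R, (0 < t < 1)%R ->
  (psi t)%:E <= K%:E * fundamental_function X t.
Variable g : R -> \bar R.
Hypothesis g_fin : forall s : R, (0 < s)%R -> rearrangement g s \is a fin_num.
Hypothesis g_int :
  \int[lebesgue_measure]_(s in `]0%R, 1%R[%classic) rearrangement g s < +oo.
Let w := weighted_oscillation psi r g.
Let r0 : (0 < r)%R. Proof. by case/andP: hr. Qed.

Let psi_gt0 (t : R) : (0 < t < 1)%R -> (0 < psi t)%R.
Proof. by move=> t01; apply: (A0_gt0 hpsi); rewrite /I01/= in_itv. Qed.

Let o (t : R) := fine (oscillation g t).

Let oE (t : R) : (0 < t < 1)%R -> oscillation g t = (o t)%:E.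
Proof. by move=> /andP[t0 t1]; rewrite /o oscillationE// ltW. Qed.

Let o_ge0 (t : R) : (0 < t < 1)%R -> (0 <= o t)%R.
Proof.
by move=> /andP[t0 t1]; apply: fine_ge0; rewrite oscillation_ge0// ltW.
Qed.

Lemma weighted_oscillationE (t : R) : (0 < t < 1)%R ->
  w t = (o t `^ r^-1 / psi t)%:E.
Proof.
move=> t01; rewrite /w /weighted_oscillation oE// poweR_EFin inver.
rewrite gt_eqF ?psi_gt0// -EFinM gee0_abs// lee_fin divr_ge0 ?powR_ge0//.
by rewrite ltW// psi_gt0.
Qed.

Lemma Mplus_weighted_oscillation : Mplus w.
Proof.
split=> [|x _]; last exact: abse_ge0.
apply: measurableT_comp => //; apply: emeasurable_funM.
  apply: (measurableT_comp (measurable_poweR _)).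
  exact: measurable_oscillation.
apply: nonincreasing_emeasurable; first exact: interval_is_interval.
move=> x y Ix Iy xy; have := A0_incr hpsi Ix Iy xy.
have px := A0_gt0 hpsi Ix; have py := A0_gt0 hpsi Iy.
by rewrite !inver !gt_eqF// lee_fin lef_pV2.
Qed.

(** On [[t, 2t[] the function [w] is at least
    [v = (O t / 2)^(1/r) / (D * psi t)], and the indicator of this interval has
    norm [phi_X t]. *)
Lemma oscillation_le_cut_norm (t y : R) : (0 < t <= 2^-1)%R ->
  X (fun x => w x * (\1_(`[t, 2 * t[%classic) x)%:E) <= y%:E ->
  oscillation g t <= (2 * (D * K * y) `^ r)%:E.
Proof.
move=> /andP[t0 t2] Xy; have t1 : (t < 1)%R by lra.
have t01 : (0 < t < 1)%R by rewrite t0.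
set E : set R := `[t, (2 * t)%R[%classic in Xy *.
have mE : measurable E by exact: measurable_itv.
have EI : E `<=` I01 R.
  by move=> x; rewrite /E /I01/= !in_itv/= => /andP[? ?]; lra.
have muE : lebesgue_measure E = t%:E.
  rewrite /E lebesgue_measure_itv/= lte_fin ifT; last by lra.
  by rewrite -EFinB; congr EFin; lra.
have [p p0 pE] := fundamental_function_gt0_fin X t hX t01.
have t01' : (0 < t <= 1)%R by rewrite t0 ltW.
have XE : X (fun x => (\1_E x)%:E) = p%:E.
  by rewrite -(fundamental_functionE X E t hX mE EI t01' muE).
pose v := ((o t / 2) `^ r^-1 / (D * psi t))%R.
have o2 : (0 <= o t / 2)%R by rewrite divr_ge0 ?o_ge0.
have v0 : (0 <= v)%R.
  by rewrite divr_ge0 ?powR_ge0// mulr_ge0 ?(ltW D0)// ltW// psi_gt0.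
have vw (x : R) : E x -> v%:E <= w x.
  move=> Ex; have := EI _ Ex; rewrite /I01/= in_itv/= => x01.
  rewrite weighted_oscillationE// lee_fin.
  move: Ex; rewrite /E/= in_itv/= => /andP[tx x2t].
  have x0 := lt_le_trans t0 tx.
  have x1 : (x <= 1)%R by lra.
  apply: ler_pM; rewrite ?powR_ge0 ?invr_ge0 ?mulr_ge0 ?(ltW D0)//.
  - by rewrite ltW// psi_gt0.
  - apply: ge0_ler_powR; rewrite ?nnegrE ?invr_ge0 ?(ltW r0) ?o_ge0//.
    have := oscillation_le_right g g_fin g_int t x t0 tx x1.
    rewrite !oE// -!EFinM lee_fin => h.
    have : (t * o t <= 2 * t * o x)%R.
      by apply: (le_trans h); rewrite ler_wpM2r ?o_ge0// ltW.
    by rewrite [(2 * t)%R]mulrC -mulrA ler_pM2l// => ?; lra.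
  - rewrite lef_pV2 ?posrE ?mulr_gt0 ?psi_gt0//.
    apply: (le_trans (psiD _ x01)); rewrite ler_pM2l//.
    by apply: (A0_incr hpsi); rewrite ?/I01/= ?in_itv/=; lra.
have vpy : (v * p <= y)%R.
  rewrite -lee_fin EFinM -XE -(bfn_homog (ri_bfn hX) v0 (Mplus_indic _ mE)).
  apply: le_trans Xy; apply: le_norm_pointwise.
  - exact: ri_bfn.
  - split=> [|x Ix]; last by rewrite mule_ge0 ?lee_fin.
    by apply: measurable_funeM; exact: (Mplus_indic _ mE).1.
  - by apply: Mplus_cut => //; exact: Mplus_weighted_oscillation.
  - move=> x Ix; rewrite indicE; case: (boolP (x \in E)) => [/set_mem Ex|_].
      by rewrite !mule1 vw.
    by rewrite !mule0.
have psip : (psi t <= K * p)%R by rewrite -lee_fin EFinM -pE psiK.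
have : ((o t / 2) `^ r^-1 <= D * K * y)%R.
  have -> : ((o t / 2) `^ r^-1 = v * (D * psi t))%R.
    by rewrite divfK// mulf_neq0 ?gt_eqF ?psi_gt0.
  apply: (@le_trans _ _ (v * (D * (K * p)))%R).
    by rewrite ler_wpM2l// ler_pM2l.
  have -> : (v * (D * (K * p)) = D * K * (v * p))%R by ring.
  have K0 : (0 <= K)%R.
    by rewrite -(pmulr_lge0 _ p0); apply: le_trans psip; rewrite ltW// psi_gt0.
  by rewrite ler_wpM2l// mulr_ge0// ltW.
move=> h; have h0 := le_trans (powR_ge0 _ _) h.
rewrite oE// lee_fin mulrC -ler_pdivrMr//.
have -> : (o t / 2 = ((o t / 2) `^ r^-1) `^ r)%R.
  by rewrite -powRrM mulVf ?powRr1// gt_eqF.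
by apply: ge0_ler_powR; rewrite ?nnegrE ?powR_ge0 ?(ltW r0).
Qed.

(** [O = (w * psi)^r], and doubling bounds [psi] near 1 by [D * psi (1/2)];
    [powR_interpolation] with threshold [b] replaces the power of [w] by [w]
    itself, whose integral the norm controls. *)
Lemma integral_oscillation_le_norm (b C : R) : (0 < b)%R -> (0 < C)%R ->
  (forall f, Mplus f ->
    \int[lebesgue_measure]_(x in `[(2^-1)%R, 1%R[%classic) f x <= C%:E * X f) ->
  X w <= b%:E ->
  \int[lebesgue_measure]_(x in `[(2^-1)%R, 1%R[%classic) oscillation g x <=
    ((D * psi 2^-1) `^ r * (1 + C) * b `^ r)%:E.
Proof.
move=> b0 C0 hC wb.
have [mw w0] := Mplus_weighted_oscillation.
pose E : set R := `[(2^-1)%R, 1%R[%classic.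
have mE : measurable E by exact: measurable_itv.
have h0 : (0 < (2^-1 : R) < 1)%R by lra.
have sub : E `<=` I01 R.
  by move=> x; rewrite /E /I01/= !in_itv/= => /andP[x0 ->]; lra.
set M := (D * psi 2^-1)%R.
have M0 : (0 < M)%R by rewrite mulr_gt0 ?psi_gt0.
pose c1 := (M `^ r * b `^ r)%R; pose c2 := (M `^ r * b `^ (r - 1))%R.
have c20 : (0 <= c2)%R by rewrite mulr_ge0 ?powR_ge0.
have c10 : (0 <= c1)%R by rewrite mulr_ge0 ?powR_ge0.
have key : \int[lebesgue_measure]_(x in E) oscillation g x <=
    \int[lebesgue_measure]_(x in E) (cst c1%:E x + c2%:E * w x).
  have mwE : measurable_fun E w.
    by apply: measurable_funS mw => //; exact: measurable_I01.
  apply: ge0_le_integral => //=.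
  - move=> x /sub; rewrite /I01/= in_itv/= => /andP[x0 x1].
    by rewrite oscillation_ge0 ?ltW.
  - apply: measurable_funS (measurable_oscillation g g_fin g_int) => //.
    exact: measurable_I01.
  - by apply: emeasurable_funD => //; exact: measurable_funeM.
  - move=> x Ex; have := sub _ Ex; rewrite /I01/= in_itv/= => x01.
    have /andP[x0 x1] := x01; have px := psi_gt0 _ x01.
    rewrite weighted_oscillationE// oE//; have ox0 := o_ge0 _ x01.
    rewrite -EFinM -EFinD lee_fin.
    set u := (o x `^ r^-1 / psi x)%R.
    have u0 : (0 <= u)%R by rewrite divr_ge0 ?powR_ge0 ?(ltW px).
    have -> : o x = (psi x `^ r * u `^ r)%R.
      rewrite -powRM// ?(ltW px)// /u mulrC divfK ?gt_eqF//.
      by rewrite -powRrM mulVf ?powRr1// gt_eqF.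
    have pM : (psi x `^ r <= M `^ r)%R.
      apply: ge0_ler_powR; rewrite ?nnegrE ?(ltW r0) ?(ltW px) ?(ltW M0)//.
      apply: (le_trans (psiD _ x01)); rewrite ler_pM2l//.
      by apply: (A0_incr hpsi); rewrite ?/I01/= ?in_itv/=; lra.
    apply: (le_trans (ler_wpM2r (powR_ge0 _ _) pM)).
    rewrite /c1 /c2 -mulrA -mulrDr ler_wpM2l ?powR_ge0//.
    have r1 : (r <= 1)%R by case/andP: hr.
    by have := powR_interpolation R r 1 b u r1 r0 b0 u0; rewrite (powRr1 u0).
apply: (le_trans key).
have mwE : measurable_fun E w.
  by apply: measurable_funS mw => //; exact: measurable_I01.
have wE0 (x : R) : E x -> 0 <= w x by move=> Ex; apply: w0; exact: sub.
rewrite ge0_integralD//=; last 2 first.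
- by move=> x Ex; rewrite mule_ge0 ?lee_fin ?wE0.
- exact: measurable_funeM.
rewrite ge0_integralZl//= /E integral_cst_itv; last by lra.
have -> : (M `^ r * (1 + C) * b `^ r)%:E = c1%:E + c2%:E * (C%:E * b%:E).
  rewrite -!EFinM -EFinD /c1 /c2; congr EFin.
  have -> : (b `^ r = b * b `^ (r - 1))%R by rewrite mulr_powRB1 ?(ltW b0).
  by ring.
apply: leeD.
  by rewrite -EFinM lee_fin; lra.
apply: lee_wpmul2l; first by rewrite lee_fin.
apply: le_trans (hC w _) _ => //.
by apply: lee_wpmul2l => //; rewrite lee_fin ltW.
Qed.

(** The first summand of the constant accounts for the step from [1] to [1/2],
    the second for the remaining [n] halvings. *)
Lemma maximal_rearrangement_dyadic_le (alpha Ca b C : R) (n : nat) :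
  (1 < alpha)%R -> (0 < Ca)%R -> (0 < K)%R -> (0 < b)%R -> (0 < C)%R ->
  lower_estimate_with X alpha Ca ->
  (forall f, Mplus f ->
    \int[lebesgue_measure]_(x in `[(2^-1)%R, 1%R[%classic) f x <= C%:E * X f) ->
  X w <= b%:E ->
  maximal_rearrangement g (2^-1 ^+ n.+1)%R - maximal_rearrangement g 1%R <=
    ((2 * ((D * psi 2^-1) `^ r * (1 + C)) + 4 * (D * K * Ca) `^ r) * b `^ r *
     n.+1%:R `^ (1 - r / alpha))%:E.
Proof.
move=> a1 Ca0 K0 b0 C0 hlow hC wb; have a0 : (0 < alpha)%R by lra.
have r1 : (r <= 1)%R by case/andP: hr.
pose t (k : nat) : R := (2^-1 ^+ k.+1)%R.
have t0 k : (0 < t k)%R by rewrite exprn_gt0// invr_gt0.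
have tS k : t k.+1 = (t k / 2)%R by rewrite /t exprSr.
have t2 k : (t k <= 2^-1)%R.
  by rewrite /t exprS ler_piMr ?invr_ge0// exprn_ile1//; lra.
have t1 k : (t k <= 1)%R by apply: le_trans (t2 k) _; lra.
have EE k : `[t k, (2 * t k)%R[%classic = dyadic_shell k :> set R.
  have -> : (2 * t k = 2^-1 ^+ k)%R by rewrite /t exprS mulrA divff// mul1r.
  by [].
pose E : nat -> set R := dyadic_shell.
have mE k : measurable (E k) by exact: measurable_dyadic_shell.
have tE : trivIset setT E by exact: trivIset_dyadic_shell.
have Mw := Mplus_weighted_oscillation.
pose Y k := X (fun x => w x * (\1_(E k) x)%:E).
have MY k : Mplus (fun x => w x * (\1_(E k) x)%:E) by exact: Mplus_cut.
have Yb k : Y k <= b%:E.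
  apply: le_trans wb; apply: le_norm_pointwise => //; first exact: ri_bfn.
  move=> x Ix; rewrite indicE; case: (x \in E k); rewrite ?mule1// mule0.
  exact: Mw.2.
pose y k := fine (Y k).
have Y0 k : 0 <= Y k by exact: bfn_ge0 (ri_bfn hX) _ (MY k).
have YE k : Y k = (y k)%:E.
  by rewrite fineK// ge0_fin_numE// (le_lt_trans (Yb k))// ltry.
have y0 k : (0 <= y k)%R by rewrite fine_ge0.
pose F (s : R) := fine (maximal_rearrangement g s).
have FE (s : R) : (0 < s)%R -> (s <= 1)%R ->
    maximal_rearrangement g s = (F s)%:E.
  by move=> s0 s1; rewrite /F maximal_rearrangementE.
have step k : (F (t k.+1) - F (t k) <= 2 * (D * K) `^ r * y k `^ r)%R.
  rewrite -lee_fin EFinB -!FE// tS.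
  apply: le_trans (maximal_rearrangement_halving g g_fin g_int _ (t0 k) (t1 k)) _.
  have t02 : (0 < t k <= 2^-1)%R by rewrite t0 t2.
  have := oscillation_le_cut_norm (t k) (y k) t02.
  have -> : (2 * (D * K) `^ r * y k `^ r = 2 * (D * K * y k) `^ r)%R.
    by rewrite -mulrA -powRM// mulr_ge0// ltW.
  by rewrite EE -/E -/(Y k) YE => /(_ (lexx _)).
have sumY : (\sum_(k < n) y k `^ alpha <= (Ca * b) `^ alpha)%R.
  have := lower_estimate_cut X alpha Ca b w E n (ri_bfn hX) a0 Ca0 hlow mE tE
    Mw (ltW b0) wb.
  rewrite -lee_fin -sumEFin; apply: le_trans.
  by apply: lee_sum => k _; rewrite -poweR_EFin -YE.
have ra : (r <= alpha)%R by lra.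
have Cab : (0 < (Ca * b) `^ alpha)%R by rewrite powR_gt0// mulr_gt0.
have := sum_powR_le R n (fun k : 'I_n => y k) r alpha _ ra r0
  (fun k => y0 k) Cab sumY.
rewrite -powRrM mulrCA divff ?gt_eqF// mulr1 => sumr.
have top : (F (t 0%N) - F 1 <= 2 * ((D * psi 2^-1) `^ r * (1 + C)) * b `^ r)%R.
  rewrite -lee_fin EFinB -!FE// {1}/t expr1 -mulrA EFinM.
  apply: le_trans (maximal_rearrangement_last_halving g g_fin g_int) _.
  apply: lee_wpmul2l => //; exact: integral_oscillation_le_norm.
have tele : (F (t n) - F (t 0%N) <=
    \sum_(k < n) (2 * (D * K) `^ r * y k `^ r))%R.
  rewrite -(telescope_sumr (fun k => F (t k)) (leq0n n)) big_mkord.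
  by apply: ler_sum => k _.
rewrite -mulr_sumr in tele.
rewrite -/(t n) !FE// -EFinB lee_fin.
have e0 : (0 <= 1 - r / alpha)%R by rewrite subr_ge0 ler_pdivrMr// mul1r.
have n1 : (1 <= n.+1%:R `^ (1 - r / alpha) :> R)%R.
  have := @ge0_ler_powR R _ e0 1%R n.+1%:R.
  by rewrite powR1; apply; rewrite ?nnegrE// ler1n.
have nS : (n%:R `^ (1 - r / alpha) <= n.+1%:R `^ (1 - r / alpha) :> R)%R.
  by rewrite ge0_ler_powR ?nnegrE// ler_nat.
set N := (_ `^ (1 - r / alpha))%R in n1 nS *.
have -> : (F (t n) - F 1 = (F (t n) - F (t 0%N)) + (F (t 0%N) - F 1))%R by ring.
rewrite mulrDl mulrDl addrC; apply: lerD.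
  apply: (le_trans top); apply: ler_peMr => //.
  by rewrite !mulr_ge0 ?powR_ge0// addr_ge0// ltW.
apply: (le_trans tele).
have -> : (4 * (D * K * Ca) `^ r * b `^ r * N =
    2 * (D * K) `^ r * (2 * (Ca * b) `^ r * N))%R.
  by rewrite !powRM ?mulr_ge0 ?(ltW D0) ?(ltW K0) ?(ltW Ca0) ?(ltW b0)//; ring.
apply: ler_wpM2l; first by rewrite mulr_ge0 ?powR_ge0.
by apply: (le_trans sumr); rewrite ler_wpM2l// mulr_ge0 ?powR_ge0.
Qed.

End weighted_oscillation_bounds.

(** * Exponential integrability from growth on dyadic shells *)

Section exponential_integrability.
Context {R : realType}.
Local Open Scope ereal_scope.
Let shell : nat -> set R := @dyadic_shell R.

(** Shell [n] contributes at most [(4/3)^(n+1) * 2^-(n+1) = (2/3)^(n+1)]. *)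
Lemma integral_dyadic_le (H : R -> \bar R) : measurable01 H ->
  (forall x, I01 R x -> 0 <= H x) ->
  (forall (n : nat) (x : R), (2^-1 ^+ n.+1 <= x < 2^-1 ^+ n)%R ->
    H x <= ((4 / 3) ^+ n.+1)%:E) ->
  int01 H <= 2%:E.
Proof.
move=> mH H0 Hle; rewrite /int01 -bigcup_dyadic_shell.
have mshell n : measurable (shell n) by exact: measurable_dyadic_shell.
have sub n : shell n `<=` I01 R.
  by rewrite -bigcup_dyadic_shell; exact: bigcup_sup.
rewrite ge0_integral_bigcup ?bigcup_dyadic_shell//;
  last exact: trivIset_dyadic_shell.
have piece n : \int[lebesgue_measure]_(x in shell n) H x <= ((2 / 3) ^+ n.+1)%:E.
  have -> : ((2 / 3) ^+ n.+1)%:E =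
      \int[lebesgue_measure]_(x in shell n)
        (cst ((4 / 3) ^+ n.+1)%:E x) :> \bar R.
    rewrite integral_cst_itv; last first.
      by apply: ler_wiXn2l; rewrite ?invr_ge0 ?invf_le1 ?ler1n.
    rewrite -EFinM; congr EFin.
    have -> : (2^-1 ^+ n - 2^-1 ^+ n.+1 = 2^-1 ^+ n.+1 :> R)%R.
      by rewrite exprS; lra.
    by rewrite -exprMn; congr (_ ^+ _)%R; lra.
  apply: ge0_le_integral => //=.
  - exact: mshell.
  - by move=> x sx; apply: H0; exact: (sub n).
  - by apply: measurable_funS mH => //; exact: measurable_I01.
  - by move=> x; rewrite /shell /dyadic_shell/= in_itv/=; exact: Hle.
apply: lime_le.
  apply: is_cvg_nneseries => n _ _.
  by apply: integral_ge0 => x sx; apply: H0; exact: (sub n).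
apply: nearW => n.
apply: (@le_trans _ _ (\sum_(0 <= i < n) ((2 / 3) ^+ i.+1)%:E)).
  by apply: lee_sum => i _; exact: piece.
rewrite sumEFin lee_fin.
have -> : (\sum_(0 <= i < n) (2 / 3) ^+ i.+1 = 2 - 2 * (2 / 3) ^+ n :> R)%R.
  elim: n => [|n IH]; first by rewrite big_geq// expr0; lra.
  by rewrite big_nat_recr//= IH exprS; lra.
by rewrite gerBl mulr_ge0// exprn_ge0//; lra.
Qed.

(** The coefficient of [q `^ beta] turns the growth hypothesis into the bound
    [ln (4/3) * (n+1)] for the exponent.  The value 2 of the bound matters: it is
    what the Luxemburg norm tolerates after subtracting 1 from the
    exponential. *)
Lemma int_expeR_le (beta M : R) (q : R -> \bar R) : (0 < beta)%R -> (0 < M)%R ->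
  measurable01 q -> (forall x, I01 R x -> 0 <= q x) ->
  (forall (n : nat) (x : R), (2^-1 ^+ n.+1 <= x < 2^-1 ^+ n)%R ->
    q x <= (M * n.+1%:R `^ beta^-1)%:E) ->
  measurable01 (fun t => expeR ((ln (4 / 3) / M `^ beta)%:E * q t `^ beta)) /\
  int01 (fun t => expeR ((ln (4 / 3) / M `^ beta)%:E * q t `^ beta)) <= 2%:E.
Proof.
move=> b0 M0 mq q0 qle.
set c := (ln (4 / 3) / M `^ beta)%R.
have l0 : (0 <= ln (4 / 3) :> R)%R by rewrite ln_ge0//; lra.
have Mb : (0 < M `^ beta)%R by rewrite powR_gt0.
have c0 : (0 <= c)%R by rewrite divr_ge0// ltW.
have qfin (x : R) : I01 R x -> q x = (fine (q x))%:E.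
  move=> Ix; rewrite fineK// ge0_fin_numE ?q0//.
  move: (Ix); rewrite /I01/= in_itv/= => /dyadic_shell_exists[n /qle].
  by move=> /le_lt_trans; apply; exact: ltry.
have mH : measurable01 (fun t => expeR (c%:E * q t `^ beta)).
  apply: (@eq_measurable_fun _ _ _ _ _
      (fun t => (expR (c * fine (q t) `^ beta))%:E)).
    by move=> x /set_mem /qfin Ix; rewrite Ix poweR_EFin -EFinM.
  apply/measurable_EFinP; apply: (measurableT_comp (@measurable_expR R)).
  apply: measurable_funM; first exact: measurable_cst.
  apply: (measurableT_comp (measurable_powR _)).
  by apply: measurableT_comp mq; exact: fine_measurable.
split=> //; apply: integral_dyadic_le => //.
  by move=> x _; exact: expeR_ge0.
move=> n x nx; have Ix : I01 R x.
  by rewrite -bigcup_dyadic_shell; exists n.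
have := qle n x nx; have := q0 x Ix; rewrite (qfin x Ix).
set u := fine _; rewrite lee_fin => u0; rewrite lee_fin => uM.
rewrite poweR_EFin -EFinM /= lee_fin.
have -> : (4 / 3 = expR (ln (4 / 3)) :> R)%R by rewrite lnK// posrE; lra.
rewrite -expRM_natl ler_expR /c mulrAC ler_pdivrMr//.
have -> : (n.+1%:R * ln (4 / 3) * M `^ beta =
    ln (4 / 3) * (M * n.+1%:R `^ beta^-1) `^ beta :> R)%R.
  rewrite powRM ?powR_ge0 ?(ltW M0)// -powRrM mulVf ?gt_eqF// powRr1//.
  by ring.
rewrite ler_wpM2l//; apply: ge0_ler_powR; rewrite ?nnegrE ?(ltW b0)//.
by rewrite mulr_ge0 ?powR_ge0// ltW.
Qed.

End exponential_integrability.

(** * Logarithmic growth of the maximal function *)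

Section integrability.
Context {R : realType}.
Local Open Scope ereal_scope.

(** Otherwise the oscillation is infinite throughout [(0, 1)], and so is [w],
    whereas a function of finite norm is integrable. *)
Lemma int_rearrangement_lty_of_norm (X : (R -> \bar R) -> \bar R)
    (psi : R -> R) (r : R) (g : R -> \bar R) :
  ri_norm X -> class_A0 psi -> (0 < r)%R ->
  (forall s : R, (0 < s)%R -> rearrangement g s \is a fin_num) ->
  X (weighted_oscillation psi r g) < +oo ->
  \int[lebesgue_measure]_(s in `]0%R, 1%R[%classic) rearrangement g s < +oo.
Proof.
move=> hX hpsi r0 g_fin Xw; have hB := ri_bfn hX.
set I := \int[_]_(_ in _) _; rewrite ltey; apply/negP => /eqP Iy.
have mI : measurable (I01 R) by exact: measurable_I01.
have wy (x : R) : I01 R x -> weighted_oscillation psi r g x = +oo.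
  rewrite /I01/= in_itv/= => x01.
  have px : (0 < psi x)%R by apply: (A0_gt0 hpsi); rewrite /I01/= in_itv.
  have -> : weighted_oscillation psi r g x =
      `|oscillation g x `^ r^-1 / (psi x)%:E| by [].
  have [oy|] := eqVneq (oscillation g x) +oo.
    rewrite oy poweRyr ?invr_neq0 ?gt_eqF// inver gt_eqF//.
    by rewrite gt0_mulye// lte_fin invr_gt0.
  rewrite -ltey => /(int_rearrangement_lty g g_fin x x01).
  by rewrite -/I Iy ltxx.
have Mw : Mplus (weighted_oscillation psi r g).
  split=> [|x _]; last exact: abse_ge0.
  apply: (@eq_measurable_fun _ _ _ _ _ (cst +oo)); last exact: measurable_cst.
  by move=> x /set_mem /wy.
have [C C0] := bfn_integral hB mI (@subset_refl _ _).
move=> /(_ _ Mw).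
rewrite (eq_integral (cst +oo)); last by move=> x /set_mem /wy.
rewrite integral_cst//= /I01 lebesgue_measure_itv/= lte_fin ltr01 oppr0 adde0.
rewrite mule1 leye_eq => /eqP CX.
have : C%:E * X (weighted_oscillation psi r g) < +oo.
  rewrite lte_mul_pinfty// ?lee_fin ?(ltW C0)//.
by rewrite CX ltxx.
Qed.

End integrability.

(** The value [a] of the oscillation norm may be 0.  Then the dyadic bound is
    applied with every positive [b] instead of the norm of [w], and [b] tends
    to 0. *)
Lemma maximal_rearrangement_log_growth (R : realType) (r alpha : R)
    (X : (R -> \bar R) -> \bar R) (psi : R -> R) :
  0 < r <= 1 -> ri_norm X -> 1 < alpha -> lower_estimate X alpha ->
  class_A0 psi ->
  (exists K : R, forall t : R, I01 R t -> (sup_ratio X psi t <= K%:E)%E) ->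
  exists2 B : R, 0 < B & forall f : R -> \bar R, measurable01 f ->
    (osc_norm X psi r f < +oo)%E -> Lpow r f ->
    let F := maximal_rearrangement (abs_pow f r) in
    exists (a : R) (phi : R -> R),
    [/\ 0 <= a, osc_norm X psi r f = a%:E, measurable01 F,
        (forall t : R, 0 < t -> t <= 1 -> F t = (phi t)%:E) &
        [/\ 0 <= phi 1,
          (forall t : R, 0 < t -> t <= 1 -> phi 1 <= phi t) &
          forall (n : nat) (t : R), 2^-1 ^+ n.+1 <= t < 2^-1 ^+ n ->
            phi t - phi 1 <= B * a * n.+1%:R `^ (1 - r / alpha)]].
Proof.
move=> hr hX a1 [Ca Ca0 hlow] hpsi [K hM].
have /andP[r0 r1] := hr.
have [D D0 psiD] := class_A0_doubling _ _ hpsi.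
pose K' := Num.max K 1.
have K'0 : 0 < K' by rewrite lt_max ltr01 orbT.
have psiK (t : R) : 0 < t < 1 ->
    ((psi t)%:E <= K'%:E * fundamental_function X t)%E.
  move=> t01; apply: sup_ratio_bound => // s Is; apply: le_trans (hM s Is) _.
  by rewrite lee_fin le_max lexx.
have h0 : 0 < (2^-1 : R) < 1 by lra.
have psi2 : 0 < psi 2^-1 by apply: (A0_gt0 hpsi); rewrite /I01/= in_itv.
have mE : measurable (`[2^-1, 1[%classic : set R) by exact: measurable_itv.
have EI : `[2^-1, 1[%classic `<=` I01 R.
  by move=> x; rewrite /I01/= !in_itv/= => /andP[x0 ->]; lra.
have [C C0 hC] := bfn_integral (ri_bfn hX) mE EI.
pose B := 2 * ((D * psi 2^-1) `^ r * (1 + C)) + 4 * (D * K' * Ca) `^ r.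
have B0 : 0 < B.
  by rewrite addr_gt0// !mulr_gt0 ?powR_gt0 ?addr_gt0 ?mulr_gt0.
exists B => // f mf Xf [_ If] F.
pose g := abs_pow f r.
have mg : measurable01 g.
  apply: (measurableT_comp (measurable_poweR _)).
  exact: measurableT_comp.
have g_fin (s : R) : 0 < s -> rearrangement g s \is a fin_num.
  apply: rearrangement_fin_num => //.
  rewrite (_ : (abse \o g)%E = g)//; apply/funext => x /=.
  by rewrite gee0_abs// poweR_ge0.
pose w := weighted_oscillation psi r g.
have XwE : osc_norm X psi r f = (X w `^ r)%E by [].
have Xw : (X w < +oo)%E.
  by move: Xf; rewrite XwE; apply: lty_poweRy; rewrite gt_eqF.
have g_int := int_rearrangement_lty_of_norm X psi r g hX hpsi r0 g_fin Xw.
have Mw : Mplus w := Mplus_weighted_oscillation psi r hpsi g g_fin g_int.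
have Xw0 : (0 <= X w)%E := bfn_ge0 (ri_bfn hX) Mw.
pose x := fine (X w).
have XwF : X w = x%:E by rewrite /x fineK// ge0_fin_numE.
have x0 : 0 <= x by rewrite fine_ge0.
pose phi (t : R) := fine (F t).
have FE (t : R) : 0 < t -> t <= 1 -> F t = (phi t)%:E.
  by move=> t0 t1; rewrite /phi /F maximal_rearrangementE.
have F_ni (s t : R) : 0 < s -> s <= t -> t <= 1 -> phi t <= phi s.
  move=> s0 st t1; rewrite -lee_fin -!FE//.
  - exact: maximal_rearrangement_nonincreasing.
  - exact: le_trans st t1.
  - exact: lt_le_trans st.
exists (x `^ r), phi; split=> //.
- exact: powR_ge0.
- by rewrite XwE XwF poweR_EFin.
- exact: measurable_maximal_rearrangement.
split.
- rewrite -lee_fin -FE//; apply: mule_ge0; first by rewrite lee_fin invr1.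
  by apply: integral_ge0 => s _; exact: rearrangement_ge0.
- by move=> t t0 t1; exact: F_ni.
move=> n t /andP[nt tn].
set N := n.+1%:R `^ (1 - r / alpha).
have N0 : 0 < N by rewrite powR_gt0// ltr0n.
have tn0 : 0 < 2^-1 ^+ n.+1 :> R by rewrite exprn_gt0// invr_gt0.
have t1 : t <= 1.
  apply: (le_trans (ltW tn)); rewrite exprn_ile1// ?invr_ge0// invf_le1// ler1n.
  by [].
have tn1 : 2^-1 ^+ n.+1 <= 1 :> R by apply: le_trans t1.
have bound (b : R) : 0 < b -> x <= b -> phi t - phi 1 <= B * b `^ r * N.
  move=> b0 xb; apply: (@le_trans _ _ (phi (2^-1 ^+ n.+1) - phi 1)).
    by rewrite lerB// F_ni.
  rewrite -lee_fin EFinB -!FE//.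
  apply: (maximal_rearrangement_dyadic_le X psi r D K' hX hpsi hr D0 psiD psiK
    g g_fin g_int alpha Ca b C n a1 Ca0 K'0 b0 C0 hlow hC).
  by rewrite -/w XwF lee_fin.
have [x00|xn0] := eqVneq x 0; last first.
  by apply: bound => //; rewrite lt_neqAle eq_sym xn0.
rewrite x00 powR0 ?gt_eqF// mulr0 mul0r.
apply/ler_addgt0Pr => e e0; rewrite add0r.
have -> : e = B * ((e / (B * N)) `^ r^-1) `^ r * N.
  rewrite -powRrM mulVf ?gt_eqF// powRr1; last first.
    by rewrite ltW// divr_gt0// mulr_gt0.
  by field; rewrite !gt_eqF.
apply: bound; first by rewrite powR_gt0// divr_gt0// mulr_gt0.
by rewrite x00 powR_ge0.
Qed.

Theorem theorem13 (R : realType) (r alpha beta : R)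
    (X : (R -> \bar R) -> \bar R) (psi : R -> R)
    (hr : 0 < r <= 1) (hX : ri_norm X)
    (halpha : 1 < alpha) (hlower : lower_estimate X alpha)
    (hpsi : class_A0 psi) (hbeta : beta = alpha / (alpha - r))
    (hinf : associate (convexification X r^-1)
              (fun s : R => (psi s `^ r / s * \1_(I01 R) s)%:E) = +oo%E)
    (hM : exists K : R, forall t : R, I01 R t -> (sup_ratio X psi t <= K%:E)%E) :
  exists c C K : R, [/\ 0 < c, 0 < C, 0 < K &
    forall f : R -> \bar R, measurable01 f ->
      (osc_norm X psi r f < +oo)%E -> Lpow r f ->
      let A : \bar R := osc_norm X psi r f in
      let F : R -> \bar R := maximal_rearrangement (abs_pow f r) in
      let m : \bar R := F 1 in
      [/\ (int01 (fun t : R => expeR (c%:E *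
             (if A == 0 then 0 else (F t - F 1%R) / A) `^ beta)) <= C%:E)%E,
          expL beta (fun t : R => (F t - F 1%R)%E),
          (expL_norm beta (fun t : R => F t - F 1%R) <= K%:E * A)%E &
          (* here 0 / 0 = 0 by the convention 0 * +oo = 0 *)
          (int01 (fun t : R => expeR (c%:E * (F t / (A + m)) `^ beta)) <= C%:E)%E]].
Proof.
have [B B0 growth] :=
  maximal_rearrangement_log_growth R r alpha X psi hr hX halpha hlower hpsi hM.
have /andP[r0 r1] := hr.
have ra : 0 < alpha - r by lra.
have a0 : 0 < alpha by lra.
have b0 : 0 < beta by rewrite hbeta divr_gt0.
have be : 1 - r / alpha = beta^-1 by rewrite hbeta; field; rewrite !gt_eqF.
have L0 : 0 < ln (4 / 3 : R) by rewrite ln_gt0//; lra.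
have B1 : 0 < 1 + B by rewrite addr_gt0.
(* with this growth constant the coefficient of the exponent is 1 *)
pose Mexp := ln (4 / 3 : R) `^ beta^-1.
have Mexp0 : 0 < Mexp by rewrite powR_gt0.
exists (ln (4 / 3) / (1 + B) `^ beta), 2, (B / Mexp); split=> //.
- by rewrite divr_gt0// powR_gt0.
- by rewrite divr_gt0.
move=> f mf Xf Lf A F m.
have [a [phi [aa AE mF FE [phi1 phi_ge growth_n]]]] := growth f mf Xf Lf.
rewrite -/F be in mF FE growth_n; rewrite -/A in AE.
have I01E (x : R) : I01 R x -> 0 < x /\ x <= 1.
  by rewrite /I01/= in_itv/= => /andP[x0 /ltW x1].
have shell01 (n : nat) (x : R) :
    2^-1 ^+ n.+1 <= x < 2^-1 ^+ n -> 0 < x /\ x <= 1.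
  move=> /andP[nx xn]; split.
    by rewrite (lt_le_trans _ nx)// exprn_gt0// invr_gt0.
  by rewrite (le_trans (ltW xn))// exprn_ile1// ?invr_ge0// invf_le1// ler1n.
have F1E : F 1 = (phi 1)%:E by rewrite FE.
have mF1 : measurable01 (fun t => F t - F 1%R)%E.
  by apply: emeasurable_funB => //; exact: measurable_cst.
have powS (n : nat) : 1 <= n.+1%:R `^ beta^-1 :> R.
  have bi : 0 <= beta^-1 by rewrite invr_ge0 ltW.
  have := @ge0_ler_powR R _ bi 1 n.+1%:R.
  by rewrite powR1; apply; rewrite ?nnegrE// ler1n.
have F0 (x : R) : I01 R x -> (0 <= F x)%E.
  move=> /I01E[x0 x1]; rewrite FE// lee_fin.
  exact: le_trans phi1 (phi_ge x x0 x1).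
have FF0 (x : R) : I01 R x -> (0 <= F x - F 1%R)%E.
  by move=> /I01E[x0 x1]; rewrite F1E FE// -EFinB lee_fin subr_ge0 phi_ge.
(* the level [e] leaves room for a vanishing oscillation norm *)
have norm_le (e : R) : 0 < e -> a <= e ->
    (expL_norm beta (fun t : R => F t - F 1%R) <= (B / Mexp * e)%:E)%E.
  move=> e0 ae; pose l := B / Mexp * e.
  have l0 : 0 < l by rewrite mulr_gt0// divr_gt0.
  apply: ereal_inf_lbound; exists l => //; split=> //.
  pose q (t : R) := (`|F t - F 1%R| / l%:E)%E.
  have mq : measurable01 q.
    apply: emeasurable_funM; last exact: measurable_cst.
    exact: measurableT_comp.
  have q0 (x : R) : I01 R x -> (0 <= q x)%E.
    move=> Ix; rewrite /q inver gt_eqF// mule_ge0// lee_fin invr_ge0 ltW//.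
  have qle (n : nat) (x : R) : 2^-1 ^+ n.+1 <= x < 2^-1 ^+ n ->
      (q x <= (Mexp * n.+1%:R `^ beta^-1)%:E)%E.
    move=> nx; have [x0 x1] := shell01 n x nx.
    rewrite /q F1E FE// -EFinB gee0_abs; last by rewrite lee_fin subr_ge0 phi_ge.
    rewrite inver gt_eqF// -EFinM lee_fin ler_pdivrMr//.
    apply: (le_trans (growth_n n x nx)).
    have -> : Mexp * n.+1%:R `^ beta^-1 * l = B * e * n.+1%:R `^ beta^-1.
      by rewrite /l; field; rewrite gt_eqF.
    by rewrite ler_wpM2r ?powR_ge0// ler_pM2l.
  have := int_expeR_le beta Mexp q b0 Mexp0 mq q0 qle.
  have -> : ln (4 / 3) / Mexp `^ beta = 1.
    by rewrite /Mexp -powRrM mulVf ?gt_eqF// powRr1 ?(ltW L0)// divff// gt_eqF.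
  move=> [mH Hle].
  pose H (t : R) := expeR (q t `^ beta).
  have HE : (fun t => expeR (1%:E * q t `^ beta)) = H.
    by apply/funext => t; rewrite mul1e.
  rewrite HE in mH Hle.
  have H1 (x : R) : (1 <= H x)%E.
    by rewrite -(@expeR0 R) lee_expeR poweR_ge0.
  have mI : measurable (I01 R) by exact: measurable_I01.
  have m1 : measurable01 (cst 1%:E : R -> \bar R) by exact: measurable_cst.
  have one : int01 (cst 1%:E : R -> \bar R) = 1%:E.
    rewrite /int01 integral_cst//= /I01 lebesgue_measure_itv/= lte_fin ltr01.
    by rewrite oppr0 adde0 mule1.
  (* the integral of [H - 1] is at most 1 because that of [H] is at most 2 *)
  have split1 : (int01 H = int01 (fun t => H t - 1) + 1)%E.
    rewrite -[X in (_ + X)%E]one /int01 -ge0_integralD//.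
    - by apply: eq_integral => x _; apply/esym; exact: subeK.
    - by move=> x _; rewrite sube_ge0.
    - exact: emeasurable_funB.
  move: Hle; rewrite split1 -leeBrDr//.
  by rewrite -EFinB (_ : 2 - 1 = 1 :> R)//; lra.
have norm_leA : (expL_norm beta (fun t : R => F t - F 1%R) <= (B / Mexp)%:E * A)%E.
  rewrite AE -EFinM; have [a00|an0] := eqVneq a 0; last first.
    by apply: norm_le => //; rewrite lt_neqAle eq_sym an0.
  rewrite a00 mulr0; apply/lee_addgt0Pr => e e0; rewrite add0e.
  have -> : e = B / Mexp * (e * (Mexp / B)) by field; rewrite !gt_eqF.
  have eM : 0 < e * (Mexp / B) by rewrite mulr_gt0// divr_gt0.
  by apply: norm_le => //; rewrite a00 ltW.
split.
- apply: (int_expeR_le _ _ _ b0 B1 _ _ _).2.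
  + rewrite AE eqe; case: (eqVneq a 0) => [_|an0]; first exact: measurable_cst.
    apply: emeasurable_funM => //; exact: measurable_cst.
  + move=> x Ix; rewrite AE eqe; case: (eqVneq a 0) => // an0.
    by rewrite inver (negbTE an0) mule_ge0 ?FF0// lee_fin invr_ge0.
  + move=> n x nx; have [x0 x1] := shell01 n x nx.
    rewrite AE eqe; case: (eqVneq a 0) => [_|an0].
      by rewrite lee_fin mulr_ge0 ?powR_ge0// ltW.
    have ap : 0 < a by rewrite lt_neqAle eq_sym an0.
    rewrite inver (negbTE an0) F1E FE// -EFinB -EFinM lee_fin ler_pdivrMr//.
    apply: (le_trans (growth_n n x nx)).
    rewrite mulrAC ler_wpM2r// ler_wpM2r ?powR_ge0// lerDr.
    exact: ler01.
- by split=> //; apply: le_lt_trans norm_leA _; rewrite AE -EFinM ltry.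
- exact: norm_leA.
apply: (int_expeR_le _ _ _ b0 B1 _ _ _).2.
- by apply: emeasurable_funM => //; exact: measurable_cst.
- move=> x Ix; apply: mule_ge0; first exact: F0.
  by rewrite inve_ge0 AE /m F1E -EFinD lee_fin addr_ge0.
move=> n x nx; have [x0 x1] := shell01 n x nx.
(* [F = (F - F 1) + F 1], and [F 1] is absorbed by the constant [1 + B] *)
have := growth_n n x nx; rewrite AE /m F1E FE// -EFinD inver.
case: (eqVneq (a + phi 1) 0) => [s0 g0|sn0 gn].
  have [a00 m0] : a = 0 /\ phi 1 = 0 by split; lra.
  have := phi_ge x x0 x1; rewrite m0 a00 mulr0 mul0r subr0 in g0 *.
  move=> g1; have -> : phi x = 0 by apply/le_anti; rewrite g0 g1.
  by rewrite mul0e lee_fin mulr_ge0 ?powR_ge0// ltW.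
have sp : 0 < a + phi 1 by rewrite lt_neqAle eq_sym sn0 addr_ge0.
rewrite -EFinM lee_fin ler_pdivrMr//.
set N := _ `^ _ in gn *.
have N1 : 1 <= N by exact: powS.
have : phi 1 <= phi 1 * N by rewrite ler_peMr.
have : 0 <= a * N by rewrite mulr_ge0 ?powR_ge0.
have : 0 <= B * (phi 1 * N) by rewrite !mulr_ge0 ?powR_ge0// ltW.
have -> : (1 + B) * N * (a + phi 1) =
  a * N + phi 1 * N + B * a * N + B * (phi 1 * N) by ring.
lra.
Qed.
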